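(* Let $\mathcal L_j=A_j(z)\partial_z^2+B_j(z)\partial_z+C_j(z)I$ ($j=1,2$) be bounded second-order differential operators, let $\phi(z)$ be an eigenfunction with eigenvalue $\kappa$, i.e. $(\mathcal L_1-\kappa\mathcal L_2)\phi=0$, put $\widetilde\phi_j=(\mathcal L_j\phi)/\phi$, and let $\epsilon(z)$ be an arbitrary decoupling factor. Then the Darboux transformed operators $\widehat{\mathcal L}_1=\kappa(\mathcal F\mathcal G_1+I)$ and $\widehat{\mathcal L}_2=\mathcal F\mathcal G_2+I$ can be expressed as $$\widehat{\mathcal L}_1=\kappa\big(\widehat A_1(z)\partial_z^2+\widehat B_1(z)\partial_z+\widehat C_1(z)I\big),\qquad \widehat{\mathcal L}_2=\widehat A_2(z)\partial_z^2+\widehat B_2(z)\partial_z+\widehat C_2(z)I,$$ where for $j=1,2$ $$\widehat A_j=\frac{A_j}{\widetilde\phi_j},\qquad \widehat B_j=\frac{B_j}{\widetilde\phi_j}+2\frac{\epsilon'}{\epsilon}\frac{A_j}{\widetilde\phi_j}+\Big(\frac{A_j}{\widetilde\phi_j}\Big)',$$ $$\widehat C_j=1+\Big(\frac{B_j}{\widetilde\phi_j}\Big)'-2\frac{A_j}{\widetilde\phi_j}\Big(\frac{\phi'}{\phi}\Big)^2+\Big(\frac{A_j(\epsilon'+\phi')}{\widetilde\phi_j}\Big)'+\frac{B_j}{\widetilde\phi_j}\Big(\frac{\epsilon'}{\epsilon}-\frac{\phi'}{\phi}\Big).$$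
   Context: $\partial_z=d/dz$, $I$ is the identity, a prime denotes $d/dz$, and $A_j,B_j,C_j,\phi,\epsilon$ are functions of $z$; products of functions and operators denote composition with multiplication operators. Explicitly, $\widetilde\phi_j=\dfrac{A_j\phi''+B_j\phi'+C_j\phi}{\phi}$, so that $\widetilde\phi_1=\kappa\widetilde\phi_2$. The first-order operators are $$\mathcal F=\frac{\phi(z)}{\epsilon(z)}\,\partial_z\,\frac1{\phi(z)}I,\qquad \mathcal G_j=\frac{1}{\widetilde\phi_j(z)\phi(z)}\big(A_j(z)\partial_z+B_j(z)\big)\phi(z)\epsilon(z)I\quad(j=1,2),$$ so that $\mathcal L_j=\widetilde\phi_j(\mathcal G_j\mathcal F+I)$.
   Formalization: In Ĉ_j the printed term (A_j(ε'+φ')/φ̃_j)' is replaced by (1/ε)(A_jε'/φ̃_j)' + (1/φ)(A_jφ'/φ̃_j)'; as printed the formula fails, e.g. for A_j=C_j=φ=κ=1, B_j=0, ε=z², where Ĉ_j is 1+2/z², not 3. *)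

(* Defs.v *)
From HB Require Import structures.
From mathcomp Require Import all_boot all_order all_algebra.
From mathcomp Require Import mathcomp_extra boolp classical_sets functions.
From mathcomp Require Import reals topology normedtype derive.

Set Implicit Arguments.
Unset Strict Implicit.
Unset Printing Implicit Defensive.

Import Order.TTheory GRing.Theory Num.Theory.
Import numFieldNormedType.Exports.

Local Open Scope ring_scope.
Local Open Scope classical_set_scope.

(* The variable z ranges over an open subset D of a numFieldType K, so that    *)
(* real and complex derivatives are treated alike. Functions are total on K    *)
(* and only constrained on D. Sums and scalar multiples of operators are those *)
(* of the function space (K -> K) -> (K -> K).                                 *)

Section DifferentialOperators.
Context {K : numFieldType}.
Implicit Types (D : set K) (A B C phi phit eps f g : K -> K).

Definition ddz : (K -> K) -> (K -> K) := fun f => f^`().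

Definition mulop g : (K -> K) -> (K -> K) := fun f z => g z * f z.

Definition diffop2 A B C : (K -> K) -> (K -> K) :=
  (mulop A \o ddz \o ddz) + (mulop B \o ddz) + mulop C.

Definition derivable_on D f := forall z, D z -> derivable f z 1.

Definition twice_derivable_on D f := derivable_on D f /\ derivable_on D (ddz f).

(* Equality of second-order differential operators as operators acting on the  *)
(* twice differentiable functions of z in D.                                   *)
Definition eqop_on D (P Q : (K -> K) -> (K -> K)) :=
  forall f, twice_derivable_on D f -> forall z, D z -> P f z = Q f z.

(* Boundedness of the operator is read as boundedness of its coefficients.    *)
Definition bounded_diffop2 D A B C :=
  [/\ [bounded A z | z in D], [bounded B z | z in D] & [bounded C z | z in D]].

Definition eigenfunction D (L1 L2 : (K -> K) -> (K -> K)) (kappa : K) phi :=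
  forall z, D z -> (L1 - kappa *: L2) phi z = 0.

Definition opratio (L : (K -> K) -> (K -> K)) phi : K -> K :=
  fun z => L phi z / phi z.

Definition Fop phi eps : (K -> K) -> (K -> K) :=
  mulop (fun z => phi z / eps z) \o ddz \o mulop (fun z => (phi z)^-1).

Definition Gop A B phit phi eps : (K -> K) -> (K -> K) :=
  mulop (fun z => (phit z * phi z)^-1) \o ((mulop A \o ddz) + mulop B)
    \o mulop (fun z => phi z * eps z).

Definition Ahat A phit : K -> K := fun z => A z / phit z.

Definition Bhat A B phit eps : K -> K := fun z =>
  B z / phit z + 2 * (ddz eps z / eps z) * (A z / phit z)
  + ddz (fun t => A t / phit t) z.

(* The published formula has (A (eps' + phi') / phit)' where this one has      *)
(* (A eps' / phit)' / eps + (A phi' / phit)' / phi. The former is a misprint:  *)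
(* it is not invariant under eps |-> c eps (c a nonzero constant), which       *)
(* leaves Fop \o Gop unchanged; A = C = phi = 1, B = 0, eps = z^2 refutes it.  *)
Definition Chat A B phit phi eps : K -> K := fun z =>
  1 + ddz (fun t => B t / phit t) z
  - 2 * (A z / phit z) * (ddz phi z / phi z) ^+ 2
  + (ddz (fun t => A t * ddz eps t / phit t) z / eps z
     + ddz (fun t => A t * ddz phi t / phit t) z / phi z)
  + B z / phit z * (ddz eps z / eps z - ddz phi z / phi z).

End DifferentialOperators.

(* Main.v *)
(* On D, with a = A / phit and b = B / phit, the Leibniz rule gives
     phi^-1 G f = a phi' (eps f) / phi^2 + (a eps') f / phi
                  + a eps f' / phi + b eps f / phi,
   and the coefficients of f'', f' and f in phi / eps times the derivative of
   this expression are Ahat, Bhat and Chat - 1. *)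

Require Import Defs.
From HB Require Import structures.
From mathcomp Require Import all_boot all_order all_algebra.
From mathcomp Require Import mathcomp_extra boolp classical_sets functions.
From mathcomp Require Import reals topology normedtype derive.
From mathcomp Require Import ring.
Import Order.TTheory GRing.Theory Num.Theory.
Import numFieldNormedType.Exports.
Local Open Scope ring_scope.
Local Open Scope classical_set_scope.

Section PointwiseDerivatives.
Context {K : numFieldType}.
Implicit Types (f g : K -> K) (z : K).

Lemma is_derive_ddz {f z} : derivable f z 1 -> is_derive z 1 f (ddz f z).
Proof. by move=> /derivableP; rewrite /ddz derive1E. Qed.

Lemma ddz_val {f z} {df : K} : is_derive z 1 f df -> ddz f z = df.
Proof. by move=> h; rewrite /ddz derive1E derive_val. Qed.

(** Over [K] as a module over itself, [*:] is multiplication. Writing the derivative values with [*]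
    keeps them in the language of [field], and the [fun t] form matches the quotients differentiated
    in [Bhat] and [Chat]. *)
Lemma is_derive_mul {f g z} {df dg : K} :
  is_derive z 1 f df -> is_derive z 1 g dg ->
  is_derive z 1 (fun t => f t * g t) (df * g z + f z * dg).
Proof.
move=> hf hg; apply: (is_derive_eq (is_deriveM hf hg)).
by rewrite /GRing.scale /= addrC [g z * _]mulrC.
Qed.

Lemma is_derive_inv {f z} {df : K} : f z != 0 -> is_derive z 1 f df ->
  is_derive z 1 (fun t => (f t)^-1) (- df / f z ^+ 2).
Proof.
move=> f0 hf; apply: DeriveDef; first exact: derivableV.
by rewrite deriveV // derive_val /GRing.scale /= mulrC mulrN mulNr.
Qed.

Lemma is_derive_div {f g z} {df dg : K} : g z != 0 ->
  is_derive z 1 f df -> is_derive z 1 g dg ->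
  is_derive z 1 (fun t => f t / g t) (df / g z - f z * dg / g z ^+ 2).
Proof.
move=> g0 hf hg; apply: is_derive_eq (is_derive_mul hf (is_derive_inv g0 hg)) _.
by rewrite mulNr mulrN mulrA.
Qed.

Lemma is_derive_add {f g z} {df dg : K} :
  is_derive z 1 f df -> is_derive z 1 g dg ->
  is_derive z 1 (fun t => f t + g t) (df + dg).
Proof. exact: is_deriveD. Qed.

End PointwiseDerivatives.

(** Leaving [phit] a general nonvanishing function lets one computation serve both indices. *)
Lemma Fop_comp_Gop (K : numFieldType) (D : set K) (A B phit phi eps : K -> K) :
  open D -> derivable_on D A -> derivable_on D B -> derivable_on D phit ->
  twice_derivable_on D phi -> twice_derivable_on D eps ->
  (forall z, D z -> phi z != 0) -> (forall z, D z -> eps z != 0) ->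
  (forall z, D z -> phit z != 0) ->
  eqop_on D ((Fop phi eps \o Gop A B phit phi eps) + idfun)
            (diffop2 (Ahat A phit) (Bhat A B phit eps) (Chat A B phit phi eps)).
Proof.
move=> oD dA dB dt [dp dp'] [de de'] p0 e0 t0 f [df df'] z Dz.
pose a t := A t / phit t; pose b t := B t / phit t.
(* These products stay single functions because [Chat] differentiates exactly them. *)
pose ap t := A t * ddz phi t / phit t; pose ae t := A t * ddz eps t / phit t.
pose q t := ap t * (eps t * f t) / (phi t * phi t) + ae t * f t / phi t
  + a t * (eps t * ddz f t) / phi t + b t * (eps t * f t) / phi t.
(* Agreement at [z] alone would not suffice, since [Fop] differentiates this function; openness of
   [D] makes the Leibniz expansion valid on a whole neighbourhood. *)
have phiGE : \near z, q z = (phi z)^-1 * Gop A B phit phi eps f z.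
  near=> t; have Dt : D t by near: t; exact: open_nbhs_nbhs.
  have hef := is_derive_mul (is_derive_mul (is_derive_ddz (dp t Dt))
    (is_derive_ddz (de t Dt))) (is_derive_ddz (df t Dt)).
  rewrite /Gop /mulop /= !fctE (ddz_val hef) /q /ap /ae /a /b.
  move: (p0 t Dt) (t0 t Dt).
  (* [field] is very slow when its atoms are the applied functions. *)
  move: (phi t) (phit t) (eps t) (f t) (A t) (B t) (ddz phi t) (ddz eps t)
    (ddz f t) => p u e g x y p' e' g' p_n0 u_n0.
  by field; rewrite p_n0.
have ha := is_derive_div (t0 z Dz) (is_derive_ddz (dA z Dz))
  (is_derive_ddz (dt z Dz)).
have hb := is_derive_div (t0 z Dz) (is_derive_ddz (dB z Dz))
  (is_derive_ddz (dt z Dz)).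
(* The second derivatives of [phi] and [eps] enter through [hap] and [hae], that of [f] through
   [hef']. *)
have hap := is_derive_div (t0 z Dz) (is_derive_mul (is_derive_ddz (dA z Dz))
  (is_derive_ddz (dp' z Dz))) (is_derive_ddz (dt z Dz)).
have hae := is_derive_div (t0 z Dz) (is_derive_mul (is_derive_ddz (dA z Dz))
  (is_derive_ddz (de' z Dz))) (is_derive_ddz (dt z Dz)).
have hp := is_derive_ddz (dp z Dz).
have hef := is_derive_mul (is_derive_ddz (de z Dz)) (is_derive_ddz (df z Dz)).
have hef' := is_derive_mul (is_derive_ddz (de z Dz)) (is_derive_ddz (df' z Dz)).
have pp0 : phi z * phi z != 0 by rewrite mulf_neq0 ?p0.
have hq := is_derive_add (is_derive_add (is_derive_add
  (is_derive_div (g := fun t => phi t * phi t) pp0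
    (is_derive_mul hap hef) (is_derive_mul hp hp))
  (is_derive_div (p0 z Dz) (is_derive_mul hae (is_derive_ddz (df z Dz))) hp))
  (is_derive_div (p0 z Dz) (is_derive_mul ha hef') hp))
  (is_derive_div (p0 z Dz) (is_derive_mul hb hef) hp).
have dG := ddz_val (near_eq_is_derive phiGE hq).
rewrite /Fop /diffop2 /Ahat /Bhat /Chat /mulop /= !fctE /= dG.
(* The derivatives inside [Bhat] and [Chat] are the ones already used for [q]. Once they are
   expanded, a rational identity remains in fifteen values at [z], which can be treated as
   independent variables. *)
rewrite (ddz_val ha) (ddz_val hb) (ddz_val hap) (ddz_val hae).
rewrite /q /ap /ae /a /b; move: (p0 z Dz) (t0 z Dz) (e0 z Dz).
move: (phi z) (phit z) (eps z) (f z) (A z) (B z) (ddz phi z) (ddz eps z)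
  (ddz f z) (ddz A z) (ddz B z) (ddz phit z) (ddz (ddz phi) z)
  (ddz (ddz eps) z) (ddz (ddz f) z) => p u e g x y p' e' g' x' y' u' p'' e'' g''.
move=> p_n0 u_n0 e_n0.
by field; rewrite p_n0 e_n0.
Unshelve. all: by end_near.
Qed.

Theorem proposition2p1 (K : numFieldType) (D : set K) (hD : open D)
  (A1 B1 C1 A2 B2 C2 phi eps : K -> K) (kappa : K)
  (L1 := diffop2 A1 B1 C1) (L2 := diffop2 A2 B2 C2)
  (phit1 := opratio L1 phi) (phit2 := opratio L2 phi)
  (bL1 : bounded_diffop2 D A1 B1 C1) (bL2 : bounded_diffop2 D A2 B2 C2)
  (dA1 : derivable_on D A1) (dB1 : derivable_on D B1)
  (dA2 : derivable_on D A2) (dB2 : derivable_on D B2)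
  (dphi : twice_derivable_on D phi) (deps : twice_derivable_on D eps)
  (dphit1 : derivable_on D phit1) (dphit2 : derivable_on D phit2)
  (phi_neq0 : forall z, D z -> phi z != 0)
  (eps_neq0 : forall z, D z -> eps z != 0)
  (phit1_neq0 : forall z, D z -> phit1 z != 0)
  (phit2_neq0 : forall z, D z -> phit2 z != 0)
  (eigen : eigenfunction D L1 L2 kappa phi) :
  eqop_on D (kappa *: ((Fop phi eps \o Gop A1 B1 phit1 phi eps) + idfun))
            (kappa *: diffop2 (Ahat A1 phit1) (Bhat A1 B1 phit1 eps)
                              (Chat A1 B1 phit1 phi eps))
  /\ eqop_on D ((Fop phi eps \o Gop A2 B2 phit2 phi eps) + idfun)
               (diffop2 (Ahat A2 phit2) (Bhat A2 B2 phit2 eps)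
                        (Chat A2 B2 phit2 phi eps)).
Proof.
(* The factor [kappa] only multiplies values, so both claims reduce to the lemma, taken with [phit1]
   and [phit2]. *)
have scaled (P Q : (K -> K) -> (K -> K)) :
    eqop_on D P Q -> eqop_on D (kappa *: P) (kappa *: Q).
  by move=> PQ f df z Dz; rewrite !fctE PQ.
by split; [apply: scaled|]; exact: Fop_comp_Gop.
Qed.
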